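(* Let $\mathcal{H}$ be a real Hilbert space, let $n\ge 2$ be an integer, and let $(\rho_1,\ldots,\rho_n),(\tau_1,\ldots,\tau_n)\in\mathbb{R}_{++}^n$. For each $i\in\{1,\ldots,n\}$, let $F_i:\mathcal{H}\to\mathcal{H}$ be $\tau_i$-cocoercive and let $(x_{i,k})_{k=0}^{\infty}$ be a sequence in $\mathcal{H}$. Let $x_1,\ldots,x_n,y\in\mathcal{H}$ and suppose that, as $k\to\infty$, \begin{align*} &\forall i\in\{1,\ldots,n\},\quad x_{i,k}\rightharpoonup x_i,\\ &\forall i\in\{1,\ldots,n\},\quad F_i(x_{i,k})\rightharpoonup y,\\ &\sum_{i=1}^n\rho_i\bigl(x_{i,k}-\tau_iF_i(x_{i,k})\bigr)\to-\Bigl(\sum_{i=1}^n\rho_i\tau_i\Bigr)y+\sum_{i=1}^n\rho_ix_i,\\ &\forall i,j\in\{1,\ldots,n\},\quad F_i(x_{i,k})-F_j(x_{j,k})\to 0. \end{align*} Then $F_1(x_1)=F_2(x_2)=\cdots=F_n(x_n)=y$.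
   Context: $\mathbb{R}_{++}=\{r\in\mathbb{R}:r>0\}$. The symbols $\rightharpoonup$ and $\to$ denote weak and strong (norm) convergence in $\mathcal{H}$, respectively. For $\tau>0$, a mapping $T:\mathcal{H}\to\mathcal{H}$ is $\tau$-cocoercive if $\langle x-y,T(x)-T(y)\rangle\ge\tau\|T(x)-T(y)\|^2$ for all $x,y\in\mathcal{H}$. *)

(* Defs.v *)
From HB Require Import structures.
From mathcomp Require Import all_boot all_order all_algebra.
From mathcomp Require Import all_classical all_reals all_analysis.

Set Implicit Arguments.
Unset Strict Implicit.
Unset Printing Implicit Defensive.

Import Order.TTheory GRing.Theory Num.Theory.
Import numFieldNormedType.Exports.

Local Open Scope classical_set_scope.
Local Open Scope ring_scope.

(* Over the reals, {dot H for idfun} is the type of symmetric positive definite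
   bilinear forms on H. *)
HB.mixin Record CompleteNormedModule_isHilbert (R : realType) (H : Type)
    of CompleteNormedModule R H := {
  inner : {dot H for idfun} ;
  inner_norm : forall u : H, inner u u = `|u| ^+ 2
}.

#[short(type="hilbertType")]
HB.structure Definition Hilbert (R : realType) :=
  {H of CompleteNormedModule_isHilbert R H & CompleteNormedModule R H}.

(* Weak convergence of sequences in a Hilbert space; by the Riesz
   representation theorem the maps x |-> inner x u are exactly the continuous
   linear functionals. *)
Definition weakly_converges (R : realType) (H : hilbertType R)
    (x : nat -> H) (l : H) : Prop :=
  forall u : H, inner (x k) u @[k --> \oo] --> inner l u.

Definition cocoercive (R : realType) (H : hilbertType R)
    (tau : R) (T : H -> H) : Prop :=
  forall x y : H, inner (x - y) (T x - T y) >= tau * `|T x - T y| ^+ 2.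

(* Main.v *)
(** Put [z i k = (x_{i,k} - x_i) - tau_i (F_i x_{i,k} - y)].  Cocoercivity of
    [F_i] at the pair [(x_{i,k}, x_i)] reads
    [0 <= <z i k, F_i x_{i,k} - F_i x_i>
          + tau_i <F_i x_i - y, F_i x_{i,k} - F_i x_i>].
    Each [z i k] tends weakly to 0 while [\sum_i rho_i z i k] tends strongly
    to 0, and the [F_i x_{i,k}] differ from a common bounded sequence by
    strongly null ones, so [\sum_i rho_i <z i k, F_i x_{i,k}>] tends to 0.
    In the limit the weighted sum of the inequalities becomes
    [0 <= - \sum_i rho_i tau_i |F_i x_i - y|^2]. *)
Require Import Defs.
From mathcomp Require Import all_boot all_order all_algebra.
From mathcomp Require Import all_classical all_reals all_analysis.
From mathcomp Require Import ring lra.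

Import Order.TTheory GRing.Theory Num.Theory.
Import numFieldNormedType.Exports.

Local Open Scope classical_set_scope.
Local Open Scope ring_scope.

Section HilbertSpace.
Context {R : realType} {H : hilbertType R}.
Implicit Types (u v w : H) (a : R).

Lemma innerC u v : inner u v = inner v u.
Proof. by rewrite hermC expr0 mul1r. Qed.

Lemma innerDl u v w : inner (u + v) w = inner u w + inner v w.
Proof. exact: linearDl. Qed.

Lemma innerBl u v w : inner (u - v) w = inner u w - inner v w.
Proof. exact: linearBl. Qed.

Lemma innerZl a u w : inner (a *: u) w = a * inner u w.
Proof. exact: linearZl_LR. Qed.

Lemma inner_suml (I : Type) (r : seq I) (f : I -> H) w :
  inner (\sum_(i <- r) f i) w = \sum_(i <- r) inner (f i) w.
Proof.
elim/big_rec2: _ => [|i u s _ <-]; first exact: linear0l.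
exact: innerDl.
Qed.

Lemma innerBr u v w : inner w (u - v) = inner w u - inner w v.
Proof. by rewrite !(innerC w) innerBl. Qed.

Lemma innerZr a u w : inner w (a *: u) = a * inner w u.
Proof. by rewrite !(innerC w) innerZl. Qed.

(** For nonzero [u] and [v], expanding the squared norm of [|v| u - |u| v] gives
    [2 |u| |v| (|u| |v| - <u,v>)], and the positive factor cancels. *)
Lemma inner_le_norm u v : inner u v <= `|u| * `|v|.
Proof.
have [->|u0] := eqVneq u 0; first by rewrite linear0l normr0 mul0r.
have [->|v0] := eqVneq v 0; first by rewrite innerC linear0l normr0 mulr0.
have uv_gt0 : 0 < `|u| * `|v| by rewrite mulr_gt0 // normr_gt0.
have := sqr_ge0 (`| `|v| *: u - `|u| *: v|).
rewrite -inner_norm !(innerBl, innerBr, innerZl, innerZr) !inner_norm.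
rewrite (innerC v u) => h.
rewrite -subr_ge0 -(pmulr_rge0 _ uv_gt0); nra.
Qed.

Lemma CauchySchwarz_inner u v : `|inner u v| <= `|u| * `|v|.
Proof.
rewrite ler_norml inner_le_norm andbT lerNl.
by have := inner_le_norm (-1 *: u) v; rewrite innerZl mulN1r scaleN1r normrN.
Qed.

(** Uniform boundedness principle for the functionals [<s k, .>]: they are pointwise bounded because
    each real sequence [<s k, u>] converges. *)
Lemma weakly_converges_bounded [s : nat -> H] [l : H] :
  weakly_converges s l -> exists M, forall k, `|s k| <= M.
Proof.
move=> sl.
pose T k : H -> R^o := inner (s k).
have T_linear f : range T f -> bounded_fun_norm f /\ linear f.
  move=> [k _ <-]; split => [r|a u v].
    exists (`|s k| * r) => u ur; apply: le_trans (CauchySchwarz_inner _ _) _.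
    exact: ler_wpM2l.
  by rewrite /T !(innerC (s k)) innerDl innerZl.
have T_bounded : pointwise_bounded (range T).
  move=> u; have /cvgP/cvg_seq_bounded/pinfty_ex_gt0[M _ sM] := sl u.
  by exists M => f [k _ <-]; exact: sM.
have [M TM] := Banach_Steinhauss T_linear T_bounded 1.
(* The maximum with 0 covers [s k = 0], where there is no unit vector to test with. *)
exists (Num.max M 0) => k; have [->|sk0] := eqVneq (s k) 0.
  by rewrite normr0 le_max lexx orbT.
have sk_gt0 : 0 < `|s k| by rewrite normr_gt0.
(* At the unit vector [s k / |s k|] the functional [T k] takes the value [|s k|]. *)
have := TM (T k) (ex_intro2 _ _ k I erefl) (`|s k|^-1 *: s k).
rewrite normrZ normfV normr_id mulVf ?gt_eqF // => /(_ (lexx _)).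
rewrite /T innerZr inner_norm expr2 mulKf ?gt_eqF // normr_id => skM.
by rewrite le_max skM.
Qed.

(** By Cauchy-Schwarz the product is at most [|s k| * M], with [M] a bound on the weakly convergent
    sequence. *)
Lemma cvg_inner_strong0_weak [s w : nat -> H] [l : H] :
  s k @[k --> \oo] --> (0 : H) -> weakly_converges w l ->
  inner (s k) (w k) @[k --> \oo] --> (0 : R).
Proof.
move=> s0 /weakly_converges_bounded[M wM].
apply: (@norm_cvg0 R R^o).
apply: (@squeeze_cvgr _ _ _ _ (cst 0) (fun k => `|s k| * M)).
- apply: nearW => k; rewrite normr_ge0 /=.
  apply: le_trans (CauchySchwarz_inner _ _) _.
  exact: ler_wpM2l.
- exact: cvg_cst.
- rewrite -(mul0r M) -(@normr0 _ H).
  by apply: cvgMr_tmp; exact: cvg_norm.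
Qed.

Lemma weakly_convergesB [s t : nat -> H] [l m : H] :
  weakly_converges s l -> weakly_converges t m ->
  weakly_converges (fun k => s k - t k) (l - m).
Proof.
move=> sl tm u; rewrite innerBl; under eq_fun do rewrite innerBl.
exact: (cvgB (sl u) (tm u)).
Qed.

Lemma weakly_convergesZ a [s : nat -> H] [l : H] :
  weakly_converges s l -> weakly_converges (fun k => a *: s k) (a *: l).
Proof.
move=> sl u; rewrite innerZl; under eq_fun do rewrite innerZl.
by apply: cvgMl_tmp; exact: sl.
Qed.

Lemma weakly_converges_cst (l : H) : weakly_converges (fun=> l) l.
Proof. by move=> u; exact: cvg_cst. Qed.

End HilbertSpace.

Lemma cvg_sum_ord {R : realType} (n : nat) (f : 'I_n -> nat -> R)
    (l : 'I_n -> R) :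
  (forall i, f i k @[k --> \oo] --> l i) ->
  \sum_(i < n) f i k @[k --> \oo] --> \sum_(i < n) l i.
Proof. by move=> fl; apply: cvg_big => //; exact: add_continuous. Qed.

Theorem theorem3p1 (R : realType) (H : hilbertType R) (n : nat)
    (n_ge2 : (2 <= n)%N)
    (rho tau : 'I_n -> R)
    (rho_gt0 : forall i, 0 < rho i) (tau_gt0 : forall i, 0 < tau i)
    (F : 'I_n -> H -> H)
    (F_cocoercive : forall i, cocoercive (tau i) (F i))
    (xs : 'I_n -> nat -> H) (x : 'I_n -> H) (y : H)
    (xs_weak : forall i, weakly_converges (xs i) (x i))
    (Fxs_weak : forall i, weakly_converges (fun k => F i (xs i k)) y)
    (sum_strong :
      \sum_(i < n) rho i *: (xs i k - tau i *: F i (xs i k)) @[k --> \oo] -->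
        - ((\sum_(i < n) rho i * tau i) *: y) + \sum_(i < n) rho i *: x i)
    (diff_strong : forall i j : 'I_n,
      F i (xs i k) - F j (xs j k) @[k --> \oo] --> (0 : H)) :
  forall i, F i (x i) = y.
Proof.
(* A reference index: [b i0] serves as the common bounded sequence. *)
pose i0 : 'I_n := Ordinal (leq_trans (isT : (0 < 2)%N) n_ge2).
pose b i k := F i (xs i k).
pose c i := F i (x i).
pose z i k := (xs i k - x i) - tau i *: (b i k - y).
have z_weak i : weakly_converges (z i) 0.
  rewrite (_ : 0 = (x i - x i) - tau i *: (y - y)); last first.
    by rewrite !subrr scaler0 subr0.
  by do ?[apply: weakly_convergesB | apply: weakly_convergesZ
         | exact: xs_weak | exact: Fxs_weak | exact: weakly_converges_cst].
have z_strong : \sum_(i < n) rho i *: z i k @[k --> \oo] --> (0 : H).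
  set L := (X in _ --> X) in sum_strong.
  have zE k : \sum_(i < n) rho i *: z i k =
      \sum_(i < n) rho i *: (xs i k - tau i *: F i (xs i k)) - L.
    rewrite /L scaler_suml -sumrN -big_split -sumrB; apply: eq_bigr => i _ /=.
    rewrite /z !scalerBr !scalerA !opprD !opprK.
    by rewrite -!addrA; congr (_ + _); rewrite addrCA; congr (_ + _); rewrite addrC.
  under eq_fun do rewrite zE.
  by have := cvgB sum_strong (cvg_cst L); rewrite subrr; exact.
(* The [rho]-weighted sum of the cocoercivity inequalities, with [b i k] split as
   [(b i k - b i0 k) + b i0 k] so that each of the four terms has a limit. *)
pose E k := \sum_(i < n) rho i * inner (z i k) (b i k - b i0 k)
  + inner (\sum_(i < n) rho i *: z i k) (b i0 k)
  - \sum_(i < n) rho i * inner (z i k) (c i)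
  + \sum_(i < n) rho i * (tau i * inner (b i k - c i) (c i - y)).
have E_ge0 k : 0 <= E k.
  rewrite /E inner_suml -big_split /= -sumrB -big_split /=.
  apply: sumr_ge0 => i _; rewrite innerZl.
  rewrite -mulrDr -mulrBr -mulrDr; apply: mulr_ge0; first exact: ltW.
  (* Since [-(b i k - y) + (c i - y) = -(b i k - c i)], the summand is [<xs i k - x i, b i k - c i>
     - tau i |b i k - c i|^2]. *)
  have := F_cocoercive i (xs i k) (x i).
  rewrite -subr_ge0 -inner_norm -/(b i k) -/(c i) (innerC (b i k - c i) (c i - y)).
  rewrite /z !(innerBl, innerZl, innerBr); lra.
have E_cvg : E k @[k --> \oo] -->
    \sum_(i < n) rho i * (0 : R) + 0 - \sum_(i < n) rho i * (0 : R)
    + \sum_(i < n) rho i * (tau i * inner (y - c i) (c i - y)).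
  (* The first two terms pair a strongly null sequence with a weakly convergent one; the last two
     test weak limits against fixed vectors. *)
  apply: cvgD; [apply: cvgB; [apply: cvgD|]|].
  - apply: cvg_sum_ord => i; apply: cvgMl_tmp.
    under eq_fun do rewrite innerC.
    exact: cvg_inner_strong0_weak (diff_strong i i0) (z_weak i).
  - exact: cvg_inner_strong0_weak z_strong (Fxs_weak i0).
  - apply: cvg_sum_ord => i; apply: cvgMl_tmp.
    by have := z_weak i (c i); rewrite linear0l.
  - apply: cvg_sum_ord => i; do 2 apply: cvgMl_tmp.
    exact: (weakly_convergesB (Fxs_weak i) (weakly_converges_cst (c i))).
have := cvgr_to_ge E_cvg (nearW _ E_ge0).
under eq_bigr do rewrite mulr0.
rewrite !big1_eq addr0 subr0 add0r.
rewrite (eq_bigr (fun i => - (rho i * tau i * `|c i - y| ^+ 2))); last first.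
  move=> i _; rewrite -inner_norm -(opprB (c i)) -scaleN1r innerZl; ring.
have term_ge0 i : true -> 0 <= rho i * tau i * `|c i - y| ^+ 2.
  by rewrite !mulr_ge0 // ltW.
rewrite sumrN oppr_ge0 => sum_le0.
(* A sum of nonnegative terms that is at most 0 vanishes termwise, and the weights [rho i * tau i]
   are positive. *)
have : \sum_(i < n) rho i * tau i * `|c i - y| ^+ 2 == 0.
  by rewrite eq_le sum_le0 sumr_ge0.
rewrite psumr_eq0 // => /allP h i.
have := h i (mem_index_enum i); rewrite /= mulf_eq0 mulf_eq0.
rewrite (gt_eqF (rho_gt0 i)) (gt_eqF (tau_gt0 i)) sqrf_eq0 normr_eq0 subr_eq0.
by move/eqP.
Qed.
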